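(* Let $n\ge 3$ be an integer. Then every AG-groupoid in $Z_{AG}^{*}(n)$ is a transitively commutative AG-groupoid.
   Context: A groupoid is a set with a binary operation. For $t,u\in Z_n=\{0,1,\dots,n-1\}$, $Z_n(t,u)$ denotes the groupoid on $Z_n$ with operation $a\cdot b = ta+ub \pmod n$. An AG-groupoid is a groupoid $G$ satisfying $(ab)c=(cb)a$ for all $a,b,c\in G$. The class $Z_{AG}^{*}(n)$ consists of the AG-groupoids $Z_n(t,u)$ with $t,u\in Z_n\setminus\{0\}$, $t\ne u$ (not necessarily relatively prime) and $t^2\equiv u\pmod n$. An AG-groupoid $G$ is transitively commutative if for all $a,b,c\in G$, $ab=ba$ and $bc=cb$ imply $ac=ca$. *)

(* Defs.v *)
(* MathComp *)
From HB Require Import structures.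
From mathcomp Require Import all_boot all_algebra.

Set Implicit Arguments.
Unset Strict Implicit.
Unset Printing Implicit Defensive.

(* A groupoid (a set with an arbitrary binary operation) is a [magmaType]. *)

Definition AG_groupoid (G : magmaType) : Prop :=
  forall a b c : G, ((a * b) * c = (c * b) * a)%g.

Definition transitively_commutative (G : magmaType) : Prop :=
  forall a b c : G, commute a b -> commute b c -> commute a c.

(* The carrier of Z_n(t, u).  As for ['Z_n], it is the set of integers mod n
   only for [1 < n]. The alias carries no structure other than the product. *)
Definition Zn_groupoid (n : nat) (t u : 'Z_n) : Type := 'Z_n.

HB.instance Definition _ (n : nat) (t u : 'Z_n) :=
  hasMul.Build (Zn_groupoid t u)
    (fun a b : 'Z_n => (t * a + u * b)%R : Zn_groupoid t u).

(* [t ^+ 2 = u] is an equation in ['Z_n], that is, t^2 = u (mod n).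
   That the members satisfy the AG law is not part of the definition: it follows
   from [t ^+ 2 = u]. *)
Inductive ZAGstar (n : nat) : magmaType -> Prop :=
  ZAGstar_intro (t u : 'Z_n) of
    (t != 0)%R & (u != 0)%R & t != u & (t ^+ 2)%R = u :
    ZAGstar n (Zn_groupoid t u).

(* Main.v *)
Require Import Defs.
From mathcomp Require Import all_boot all_algebra.
From mathcomp Require Import ring.

(** Write [a . b = t a + u b].  Since [t ^+ 2 = u], the product [(a . b) . c]
    is [u a + t u b + u c], which is symmetric in [a] and [c]: this is the AG
    law.  Two elements commute exactly when [t - u] annihilates their
    difference ([Zn_groupoid_commuteE]).  The annihilator of [t - u] is an
    additive subgroup, so commutation is congruence modulo that subgroup, hence
    transitive, even though [t - u] may be a zero divisor. *)

Import GRing.Theory.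
Local Open Scope ring_scope.

Lemma Zn_groupoid_AG (n : nat) (t u : 'Z_n) :
  t ^+ 2 = u -> AG_groupoid (Zn_groupoid t u).
Proof.
move=> tu a b c.
change (t * (t * a + u * b) + u * c = t * (t * c + u * b) + u * a :> 'Z_n).
by rewrite -tu; ring.
Qed.

(** The two products of [a] and [b] differ by [(t - u) * (a - b)]. *)
Lemma Zn_groupoid_commuteE (n : nat) (t u : 'Z_n) (a b : Zn_groupoid t u) :
  commute a b <-> (t - u) * ((a : 'Z_n) - b) = 0 :> 'Z_n.
Proof.
change (t * a + u * b = t * b + u * a :> 'Z_n <->
        (t - u) * ((a : 'Z_n) - b) = 0 :> 'Z_n).
have -> : (t - u) * ((a : 'Z_n) - b) =
          (t * a + u * b) - (t * b + u * a) :> 'Z_n by ring.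
by split=> [->|/subr0_eq //]; rewrite subrr.
Qed.

Lemma Zn_groupoid_transitively_commutative (n : nat) (t u : 'Z_n) :
  transitively_commutative (Zn_groupoid t u).
Proof.
move=> a b c /Zn_groupoid_commuteE ab /Zn_groupoid_commuteE bc.
apply/Zn_groupoid_commuteE.
by rewrite -(subrKA (b : 'Z_n) a) mulrDr ab bc addr0.
Qed.

Local Close Scope ring_scope.

Theorem theorem4 (n : nat) (hn : 3 <= n) (G : magmaType) (hG : ZAGstar n G) :
  AG_groupoid G /\ transitively_commutative G.
Proof.
case: hG => t u _ _ _ tu; split; first exact: Zn_groupoid_AG.
exact: Zn_groupoid_transitively_commutative.
Qed.
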